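(* Let $n,m\in\mathbb{N}$ and $s_0,\dots,s_{n-1}\in\mathbb{Q}$. If the $(n,m)$-form $$x=s_0+s_1\sqrt[n]{m}+\dots+s_{n-1}\sqrt[n]{m^{n-1}}$$ is a root of the equation $$x^n=a_{n1}x^{n-1}+a_{n2}x^{n-2}+\dots+a_{n,n-1}x+a_{n,n},$$ then the coefficients of this equation are equal to $$a_{n,j}=(-1)^{j-1}\sum_{1\le i_1<i_2<\dots<i_j\le n}X\begin{pmatrix} i_1&i_2&\dots&i_j\\ i_1&i_2&\dots&i_j\end{pmatrix},$$ where $$X\begin{pmatrix} i_1&i_2&\dots&i_j\\ i_1&i_2&\dots&i_j\end{pmatrix}$$ are the principal minors of the matrix $$X=\begin{pmatrix} s_0 & ms_{n-1} & ms_{n-2} & \cdots & ms_2 & ms_1\\ s_1 & s_0 & ms_{n-1} & \cdots & ms_3 & ms_2\\ s_2 & s_1 & s_0 & \cdots & ms_4 & ms_3\\ \vdots & \cdots & \cdots & \cdots & \cdots & \vdots\\ s_{n-2} & s_{n-3} & s_{n-4} & \cdots & s_0 & ms_{n-1}\\ s_{n-1} & s_{n-2} & s_{n-3} & \cdots & s_1 & s_0 \end{pmatrix}.$$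
   Context: An $(n,m)$-form is a real number of the form $s_0+s_1\sqrt[n]{m}+\dots+s_{n-1}\sqrt[n]{m^{n-1}}$, with real $n$-th roots. The principal minor $X\begin{pmatrix} i_1&\dots&i_j\\ i_1&\dots&i_j\end{pmatrix}$ with $i_1<i_2<\dots<i_j$ is the determinant of the $j\times j$ submatrix of $X$ formed by the rows and columns numbered $i_1,\dots,i_j$. Numbering rows and columns of $X$ by $0,\dots,n-1$, the entry in row $i$ and column $k$ is $s_{i-k}$ if $i\ge k$ and $m\,s_{n+i-k}$ if $i<k$. The index $j$ runs over $1,\dots,n$.
   Formalization: That x is a root of the equation with the stated coefficients is shown in all cases; that the coefficients must equal the formula is shown for rational coefficients and when x is not a root of a nonzero rational polynomial of degree less than n, since otherwise they are not determined. *)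

(* Defs.v *)
From mathcomp Require Import all_boot all_order all_algebra.
From mathcomp Require Import reals exp.

Set Implicit Arguments.
Unset Strict Implicit.
Unset Printing Implicit Defensive.

Import Order.TTheory GRing.Theory Num.Theory.
Local Open Scope ring_scope.

(* Sequences [s] and [a] are total functions on [nat]; only s_0, ..., s_(n-1)
   and a_1, ..., a_n are ever used. *)

(* For n > 0 and c >= 0, [c `^ n%:R^-1] is the real n-th root of c. *)
Definition nm_form (R : realType) (n m : nat) (s : nat -> rat) : R :=
  \sum_(k < n) ratr (s k) * (m ^ k)%:R `^ n%:R^-1.

Definition nm_matrix (n m : nat) (s : nat -> rat) : 'M[rat]_n :=
  \matrix_(i < n, k < n)
    if (k <= i)%N then s (i - k)%N else m%:R * s (n + i - k)%N.

(* The indices i_1 < ... < i_j are encoded by the set I = {i_1, ..., i_j};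
   on a set of ordinals, [enum_val] lists the elements in increasing order. *)
Definition principal_minor (n : nat) (A : 'M[rat]_n) (I : {set 'I_n}) : rat :=
  \det (mxsub (@enum_val _ (mem I)) (@enum_val _ (mem I)) A).

Definition coef_formula (n m : nat) (s : nat -> rat) (j : nat) : rat :=
  (-1) ^+ (j - 1) *
  \sum_(I : {set 'I_n} | #|I| == j) principal_minor (nm_matrix n m s) I.

(* x^n = a_1 x^(n-1) + ... + a_(n-1) x + a_n *)
Definition solves_equation (R : realType) (n : nat) (a : nat -> rat) (x : R) :=
  x ^+ n = \sum_(1 <= j < n.+1) ratr (a j) * x ^+ (n - j).

(* No nonzero rational polynomial of degree < n vanishes at x; [size p] is
   deg p + 1. A number satisfying a monic rational equation of degree n
   determines the coefficients of that equation exactly when this holds. *)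
Definition degree_ge (R : realType) (n : nat) (x : R) : Prop :=
  forall p : {poly rat}, p != 0 -> root (map_poly ratr p) x -> (n < size p)%N.

(* Main.v *)
Require Import Defs.
From mathcomp Require Import all_boot all_order all_algebra.
From mathcomp Require Import reals exp.

Set Implicit Arguments.
Unset Strict Implicit.
Unset Printing Implicit Defensive.

Import Order.TTheory GRing.Theory Num.Theory.
Local Open Scope ring_scope.

(** With t the real n-th root of m, the row vector (1, t, ..., t^(n-1)) is a
    left eigenvector of the matrix X for the eigenvalue x, because t^n = m turns
    column k of X into the coefficients of t^k x (form_eigenvalue).  So x is a
    root of the characteristic polynomial of X.

    The coefficients of that polynomial are signed sums of principal minors
    (char_poly_minors): expand det('X - A) by multilinearity in the rows, taking
    in each row either -A or the diagonal term.  The summand that takes -A in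
    the rows of I is a determinant whose other rows are multiples of unit
    vectors; Sylvester's identity det(1 + UV) = det(1 + VU) identifies it with
    the minor of A on I (det_unit_rows), with no bookkeeping of permutations
    and signs.

    For the converse, two monic rational polynomials of degree n that vanish at
    x differ by a polynomial of degree less than n vanishing at x; if there is
    no such nonzero polynomial, their coefficients agree. *)

(** Both sides are the determinant of the block matrix (1, U; -V, 1), computed
    by eliminating one or the other off-diagonal block. *)
Lemma det_sylvester (R : comPzRingType) (m n : nat)
    (U : 'M[R]_(m, n)) (V : 'M[R]_(n, m)) :
  \det (1%:M + U *m V) = \det (1%:M + V *m U).
Proof.
have blockE : block_mx (1%:M + U *m V) U 0 1%:M *m block_mx 1%:M 0 (- V) 1%:M =
    block_mx 1%:M 0 (- V) 1%:M *m block_mx 1%:M U 0 (1%:M + V *m U).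
  rewrite !mulmx_block !mulmx1 !mul1mx !mul0mx !mulmx0 !mulmxN !mulNmx.
  by rewrite !add0r !addr0 addrK addrCA addNr addr0.
by move/(congr1 determinant): blockE;
  rewrite !det_mulmx !det_ublock !det_lblock !det1 !(mul1r, mulr1).
Qed.

(** Multilinearity in the rows, read off the Leibniz formula: each product over
    the rows is expanded by choosing A on I and B off I. *)
Lemma det_add_rows (R : comPzRingType) (n : nat) (A B : 'M[R]_n) :
  \det (A + B) =
  \sum_(I : {set 'I_n})
    \det (\matrix_(i < n, j < n) if i \in I then A i j else B i j).
Proof.
rewrite [RHS]exchange_big /=; apply: eq_bigr => sigma _.
rewrite -big_distrr /=; congr (_ * _).
under eq_bigr do rewrite mxE.
rewrite bigA_distr; apply: eq_bigr => I _; apply: eq_bigr => i _.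
by rewrite mxE.
Qed.

(** Pulling the factor c out of the rows outside I leaves the identity plus
    U V, where V consists of the rows of A - 1 indexed by I and U puts them
    back in their places; 1 + V U is then the submatrix of A on I. *)
Lemma det_unit_rows (R : comPzRingType) (n : nat) (A : 'M[R]_n) (c : R)
    (I : {set 'I_n}) :
  \det (\matrix_(i < n, j < n) if i \in I then A i j else c *+ (i == j)) =
  c ^+ (n - #|I|) *
    \det (mxsub (@enum_val _ (mem I)) (@enum_val _ (mem I)) A).
Proof.
set f := @enum_val _ (mem I).
pose d : 'rV[R]_n := \row_i if i \in I then 1 else c.
pose U : 'M[R]_(n, #|I|) := colsub f 1%:M.
pose V : 'M[R]_(#|I|, n) := rowsub f (A - 1%:M).
have UVE i j : (U *m V) i j = if i \in I then A i j - (i == j)%:R else 0.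
  rewrite mxE.
  transitivity (\sum_(k in I) (i == k)%:R * (A - 1%:M) k j).
    by rewrite [RHS]big_enum_val; apply: eq_bigr => k _; rewrite !mxE.
  case: ifPn => [iI | iNI].
    rewrite (bigD1 i) //= eqxx mul1r big1 => [|k /andP[_ /negbTE kNi]].
      by rewrite addr0 !mxE.
    by rewrite eq_sym kNi mul0r.
  rewrite big1 // => k kI; case: eqP => [ik | _]; last by rewrite mul0r.
  by rewrite ik kI in iNI.
have -> : \matrix_(i < n, j < n) (if i \in I then A i j else c *+ (i == j)) =
    diag_mx d *m (1%:M + U *m V).
  apply/matrixP => i j; rewrite mul_diag_mx [LHS]mxE [RHS]mxE [(1%:M + _) _ _]mxE UVE !mxE.
  by case: ifP => _; [rewrite mul1r addrC subrK | rewrite addr0 mulr_natr].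
rewrite det_mulmx det_diag det_sylvester; congr (_ * _).
  have -> : (n - #|I| = #|~: I|)%N by rewrite [RHS]cardsCs setCK card_ord.
  rewrite -prodr_const.
  rewrite [RHS]big_mkcond; apply: eq_bigr => i _.
  by rewrite mxE inE; case: (i \in I).
congr (\det _); rewrite -mxsub_mul mulmx1; apply/matrixP => k l.
by rewrite !mxE (inj_eq enum_val_inj) addrC subrK.
Qed.

(** Row expansion of det(-A + 'X): the choice I of rows taken from -A leaves
    'X in the n - |I| other rows and the sign (-1)^|I| from the minor of -A. *)
Lemma char_poly_minors (R : comNzRingType) (n : nat) (A : 'M[R]_n) :
  char_poly A =
  \sum_(I : {set 'I_n})
    ((-1) ^+ #|I| *
      \det (mxsub (@enum_val _ (mem I)) (@enum_val _ (mem I)) A)) *: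
    'X^(n - #|I|).
Proof.
rewrite /char_poly /char_poly_mx addrC det_add_rows.
apply: eq_bigr => I _.
have -> : \matrix_(i < n, j < n)
    (if i \in I then (- map_mx polyC A) i j else 'X%:M i j) =
  \matrix_(i < n, j < n)
    (if i \in I then (- map_mx polyC A) i j else 'X *+ (i == j)).
  by apply/matrixP => i j; rewrite !mxE.
rewrite det_unit_rows -map_mxN -map_mxsub det_map_mx -scaleN1r.
rewrite (_ : mxsub _ _ _ = -1 *: mxsub (@enum_val _ (mem I))
  (@enum_val _ (mem I)) A); last by apply/matrixP => i j; rewrite !mxE.
by rewrite detZ mulrC mul_polyC.
Qed.

Definition equation_poly (n : nat) (a : nat -> rat) : {poly rat} :=
  'X^n - \sum_(1 <= j < n.+1) a j *: 'X^(n - j).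

Lemma solves_equationE (R : realType) (n : nat) (a : nat -> rat) (x : R) :
  solves_equation n a x <-> root (map_poly ratr (equation_poly n a)) x.
Proof.
rewrite /solves_equation /equation_poly rmorphB /= map_polyXn raddf_sum /=.
rewrite rootE hornerD hornerN hornerXn horner_sum subr_eq0.
under [X in _ <-> _ == X]eq_bigr do
  rewrite map_polyZ map_polyXn hornerZ hornerXn.
by split=> [->|/eqP].
Qed.

(** The leading terms cancel, which lowers the degree below n. *)
Lemma equation_poly_sub (n : nat) (a b : nat -> rat) :
  equation_poly n a - equation_poly n b =
  \sum_(1 <= j < n.+1) (b j - a j) *: 'X^(n - j).
Proof.
rewrite /equation_poly opprB addrC addrA subrK -sumrB.
by apply: eq_bigr => j _; rewrite scalerBl.
Qed.

Lemma solves_equation_unique (R : realType) (n : nat) (a b : nat -> rat)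
    (x : R) :
  degree_ge n x -> solves_equation n a x -> solves_equation n b x ->
  forall j : nat, (1 <= j <= n)%N -> a j = b j.
Proof.
move=> deg_x /solves_equationE xa /solves_equationE xb j /andP[j_gt0 le_jn].
pose p := equation_poly n a - equation_poly n b.
have pE : p = \sum_(1 <= k < n.+1) (b k - a k) *: 'X^(n - k).
  exact: equation_poly_sub.
have size_p : (size p <= n)%N.
  rewrite pE big_nat; apply: (leq_trans (size_sum _ _ _)).
  apply/bigmax_leqP_seq => k _ /andP[k_gt0 _].
  rewrite (leq_trans (size_scale_leq _ _)) // size_polyXn.
  by rewrite ltn_subrL k_gt0 (leq_trans j_gt0).
have p0 : p = 0.
  apply/eqP; apply: contraTT size_p => p_neq0; rewrite -ltnNge.
  apply: deg_x => //; rewrite rmorphB rootE hornerD hornerN.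
  by rewrite (rootP xa) (rootP xb) subrr.
have : p`_(n - j) = b j - a j.
  rewrite pE coef_sum (bigD1_seq j) ?iota_uniq ?mem_index_iota ?j_gt0 //=.
  rewrite coefZ coefXn eqxx mulr1 big_nat_cond big1 ?addr0 // => k.
  move=> /andP[/andP[_ le_kn] k_neq_j]; rewrite coefZ coefXn.
  by rewrite eqn_sub2lE // eq_sym (negbTE k_neq_j) mulr0.
by rewrite p0 coef0 => /esym/subr0_eq ->.
Qed.

(** The subsets of rows are grouped by cardinality: the empty set gives the
    leading term 'X^n and the sets of size j give the coefficient of 'X^(n - j),
    which carries the opposite sign on the other side of the equation. *)
Lemma char_poly_equation (n m : nat) (s : nat -> rat) :
  char_poly (nm_matrix n m s) = equation_poly n (coef_formula n m s).
Proof.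
rewrite char_poly_minors /equation_poly.
have card_lt (I : {set 'I_n}) : (#|I| < n.+1)%N.
  by rewrite ltnS -[leqRHS]card_ord max_card.
rewrite (partition_big (fun I => Ordinal (card_lt I)) xpredT) //=.
rewrite -(big_mkord xpredT (fun j => \sum_(I : {set 'I_n} | #|I| == j)
  ((-1) ^+ #|I| * principal_minor (nm_matrix n m s) I) *: 'X^(n - #|I|))).
rewrite big_ltn //; congr (_ + _).
  rewrite (big_pred1 set0) => [|I]; last exact: cards_eq0.
  rewrite cards0 subn0 expr0 mul1r /principal_minor.
  (* The index type 'I_#|set0| must be replaced by 'I_0 in the type of the
     enumeration as well, hence the generalization. *)
  move: (@enum_val _ _); rewrite cards0 => f.
  by rewrite det_mx00 scale1r.
rewrite -sumrN !big_nat; apply: eq_bigr => j /andP[j_gt0 _].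
rewrite -scaleNr /coef_formula big_distrr -sumrN scaler_suml.
apply: eq_bigr => I /eqP ->; congr (_ *: _).
by rewrite -mulNr -[in LHS](prednK j_gt0) exprS mulN1r subn1.
Qed.

Lemma nm_formE (R : realType) (n m : nat) (s : nat -> rat) :
  nm_form R n m s = \sum_(k < n) ratr (s k) * (m%:R `^ n%:R^-1) ^+ k.
Proof.
apply: eq_bigr => k _; congr (_ * _).
by rewrite natrX -!powR_mulrn ?powR_ge0 // -!powRrM mulrC.
Qed.

(** The left eigenvector is (1, t, ..., t^(n-1)).  In column k, the rows i >= k
    contribute the terms s_l t^(l+k) with l = i - k < n - k, and the rows i < k
    the terms with l = n + i - k >= n - k, since m t^i = t^(n+i) = t^(l+k). *)
Lemma form_eigenvalue (F : fieldType) (f : {rmorphism rat -> F}) (n m : nat)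
    (s : nat -> rat) (t : F) :
  (0 < n)%N -> t ^+ n = m%:R ->
  eigenvalue (map_mx f (nm_matrix n m s)) (\sum_(k < n) f (s k) * t ^+ k).
Proof.
move=> n_gt0 tn; apply/eigenvalueP; exists (\row_(i < n) t ^+ i); last first.
  apply/eqP => /rowP /(_ (Ordinal n_gt0)); rewrite !mxE expr0.
  by apply/eqP; rewrite oner_eq0.
apply/rowP => k; rewrite !mxE.
under eq_bigr do rewrite !mxE.
have le_kn : (k <= n)%N by exact: ltnW.
rewrite -(big_mkord xpredT (fun i => t ^+ i * f (if (k <= i)%N then
  s (i - k)%N else m%:R * s (n + i - k)%N))).
rewrite -(big_mkord xpredT (fun l => f (s l) * t ^+ l)).
rewrite (big_cat_nat _ le_kn) //=.
rewrite [X in _ = X * _](big_cat_nat _ (leq_subr k n)) //=.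
rewrite mulrDl addrC !mulr_suml; congr (_ + _).
  rewrite -{1}[k : nat]add0n big_addn; apply: eq_bigr => i _.
  by rewrite leq_addl addnK exprD mulrC mulrA.
rewrite -{1}[(n - k)%N]add0n big_addn subKn // !big_nat.
apply: eq_bigr => i /andP[_ lt_ik].
rewrite leqNgt lt_ik /= rmorphM rmorph_nat -tn -addnBAC // [(n - k + i)%N]addnC.
by rewrite -mulrA -exprD -addnA subnK // exprD mulrA mulrC.
Qed.

Theorem mainTheorem3 (R : realType) (n m : nat) (s : nat -> rat) (hn : (0 < n)%N) :
  solves_equation n (coef_formula n m s) (nm_form R n m s) /\
  (degree_ge n (nm_form R n m s) ->
   forall a : nat -> rat,
     solves_equation n a (nm_form R n m s) ->
     forall j : nat, (1 <= j <= n)%N -> a j = coef_formula n m s j).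
Proof.
have form_root : solves_equation n (coef_formula n m s) (nm_form R n m s).
  apply/solves_equationE; rewrite -char_poly_equation map_char_poly.
  rewrite -eigenvalue_root_char nm_formE; apply: form_eigenvalue => //.
  by rewrite -powR_mulrn ?powR_ge0 // -powRrM mulVf ?powRr1 ?pnatr_eq0 -?lt0n.
split=> // deg_x a a_root.
exact: solves_equation_unique deg_x a_root form_root.
Qed.
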